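(* Let $b\ge4$ be an even base, $B=b-1$. Suppose a Kaprekar index $\mathbf k=(k_0,k_1,\ldots,k_B)$ is either symmetric or almost-symmetric, with not all the $k_i$ ($i=1,2,\ldots,B-1$) equal to each other. Then $\mathbf k$ is a member of a cycle of the Kaprekar transformation with length equal to $\sigma(B)$ or a divisor of $\sigma(B)$; this includes the possibility of a fixed point (a cycle of length $1$).
   Context: Integers with digit-count $n$ in base $b$ are identified with strings of exactly $n$ base-$b$ digits (leading zeros allowed). If $a_0\le a_1\le\cdots\le a_{n-1}$ are the base-$b$ digits of $x$ in ascending order, the Kaprekar transformation is $T_{b,n}(x)=\sum_{j=0}^{n-1}a_jb^j-\sum_{j=0}^{n-1}a_jb^{n-1-j}$, again regarded as an $n$-digit string. The Kaprekar index of $x$ is the $b$-tuple $\mathbf k=(k_0,\ldots,k_{B})$, where $k_i$ is the number of occurrences of the digit $i$ among the $n$ digits (so $n=\sum_i k_i$). $T_{b,n}(x)$ depends only on $\mathbf k$; the Kaprekar index of $T_{b,n}(x)$ is the successor $\mathbf k'$ of $\mathbf k$. A Kaprekar index $\mathbf k$ is a member of a cycle of length $l\ge1$ if $l$ is the least positive integer such that the $l$-th iterated successor of $\mathbf k$ equals $\mathbf k$ (length $1$ meaning a fixed point, $\mathbf k'=\mathbf k$). A Kaprekar index is full if $k_i\ge1$ for $i=0,\ldots,B$. A full index is symmetric if $k_{B-i}=k_i$ for $i=0,1,\ldots,B$. A full index is almost-symmetric if $k_{B-i}=k_i$ for $i=1,\ldots,B-1$ and $k_0<k_B<k_0+\min\{k_i:1\le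 i\le B-1\}$. For any odd integer $r\ge3$, $\sigma(r)$ is the least positive integer such that $2^{\sigma(r)}\equiv\pm1\pmod r$. *)

(* Defs.v *)
From mathcomp Require Import all_boot all_order all_algebra.
From mathcomp Require Import cyclic zify.
Set Implicit Arguments. Unset Strict Implicit. Unset Printing Implicit Defensive.

Local Open Scope nat_scope.

(* The n base-b digits of x, least significant first, leading zeros included. *)
Definition digits (b n x : nat) : seq nat :=
  mkseq (fun j => x %/ b ^ j %% b) n.

Definition of_digits (b : nat) (s : seq nat) : nat :=
  \sum_(j < size s) nth 0 s j * b ^ j.

(* The truncated subtraction is exact, see [kaprekar_subK]. *)
Definition kaprekar (b n x : nat) : nat :=
  let a := sort leq (digits b n x) in
  \sum_(j < n) nth 0 a j * b ^ j - \sum_(j < n) nth 0 a j * b ^ (n - 1 - j).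

Definition kindex (b n x : nat) : b.-tuple nat :=
  [tuple count_mem (i : nat) (digits b n x) | i < b].

(* A canonical integer with Kaprekar index k, see [kindex_krepr]. *)
Definition krepr (b : nat) (k : b.-tuple nat) : nat :=
  of_digits b (flatten (mkseq (fun i => nseq (nth 0 k i) i) b)).

(* By [ksuccE], the choice of the representative does not matter. *)
Definition ksucc (b : nat) (k : b.-tuple nat) : b.-tuple nat :=
  kindex b (sumn k) (kaprekar b (sumn k) (krepr k)).

Definition in_cycle_of_length (b : nat) (k : b.-tuple nat) (l : nat) : Prop :=
  [/\ 0 < l, iter l (@ksucc b) k = k &
      forall m, 0 < m -> iter m (@ksucc b) k = k -> l <= m].

Definition full_index (b : nat) (k : b.-tuple nat) : Prop :=
  forall i, i < b -> 1 <= nth 0 k i.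

Definition symmetric_index (b : nat) (k : b.-tuple nat) : Prop :=
  full_index k /\ forall i, i < b -> nth 0 k (b.-1 - i) = nth 0 k i.

(* For 3 <= b the default value k_1 of the minimum is one of its arguments. *)
Definition almost_symmetric_index (b : nat) (k : b.-tuple nat) : Prop :=
  [/\ full_index k,
      forall i, 1 <= i < b.-1 -> nth 0 k (b.-1 - i) = nth 0 k i &
      nth 0 k 0 < nth 0 k b.-1
        < nth 0 k 0 + \big[minn/nth 0 k 1]_(1 <= i < b.-1) nth 0 k i].

Definition pow2_pm1 (r s : nat) : bool :=
  ((2 ^ s)%N%:Z == 1 %[mod r])%Z || ((2 ^ s)%N%:Z == -1 %[mod r])%Z.

Lemma sigma_ex (r : nat) : exists s, (0 < s) && (odd r ==> pow2_pm1 r s).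
Proof.
case: (boolP (odd r)) => [or|_]; last by exists 1.
have r0 : 0 < r by case: r or.
exists (totient r); rewrite totient_gt0 r0 /=; apply/orP; left.
rewrite (modz_nat 1) modz_nat; apply/eqP; congr Posz.
by apply: Euler_exp_totient; rewrite coprime2n.
Qed.

(* The parity guard only makes sigma total: for odd r it is vacuous. *)
Definition sigma (r : nat) : nat := ex_minn (sigma_ex r).

Lemma sigmaP (r : nat) : odd r ->
  [/\ 0 < sigma r, pow2_pm1 r (sigma r) &
      forall s, 0 < s -> pow2_pm1 r s -> sigma r <= s].
Proof.
move=> or; rewrite /sigma; case: ex_minnP => s; rewrite or /=.
by case/andP=> s0 ps mins; split=> // t t0 pt; apply: mins; rewrite t0.
Qed.

Lemma size_digits b n x : size (digits b n x) = n.
Proof. exact: size_mkseq. Qed.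

Lemma digitsK b s : all (fun d => d < b) s ->
  digits b (size s) (of_digits b s) = s.
Proof.
elim: s => [//|d s IH] /= /andP[db sb].
have b0 : 0 < b by apply: leq_ltn_trans db.
have E : of_digits b (d :: s) = of_digits b s * b + d.
  rewrite /of_digits /= big_ord_recl /= muln1 addnC big_distrl /=.
  congr (_ + _); apply: eq_bigr => i _.
  by rewrite /bump /= add1n expnSr mulnA.
rewrite /digits /mkseq /= E expn0 divn1 modnMDl modn_small //; congr (_ :: _).
rewrite -[in RHS](IH sb) /digits /mkseq (iotaDl 1 0) -map_comp.
apply: eq_map => j /=.
by rewrite add1n expnS divnMA divnMDl // (divn_small db) addn0.
Qed.

Lemma count_mem_flatten_nseq (k : nat -> nat) m i :
  count_mem i (flatten (mkseq (fun i => nseq (k i) i) m))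
    = if i < m then k i else 0.
Proof.
elim: m => [//|m IH].
rewrite mkseqS flatten_rcons count_cat IH count_nseq /= ltnS.
rewrite [in RHS]leq_eqVlt; case: eqVneq => [->|_] /=.
  by rewrite ltnn mul1n.
by rewrite mul0n addn0.
Qed.

Lemma kindex_krepr (b : nat) (k : b.-tuple nat) :
  kindex b (sumn k) (krepr k) = k.
Proof.
set s := flatten (mkseq (fun i => nseq (nth 0 k i) i) b).
have sz : size s = sumn k.
  rewrite size_flatten /shape -map_comp; congr sumn.
  rewrite -[RHS](mkseq_nth 0) size_tuple; apply: eq_map => j /=.
  by rewrite size_nseq.
have sb : all (fun d => d < b) s.
  apply/allP => d; apply: contraLR; rewrite -leqNgt => bd.
  by rewrite -has_pred1 has_count count_mem_flatten_nseq [d < b]ltnNge bd.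
apply: eq_from_tnth => i; rewrite tnth_mktuple /krepr -sz digitsK //.
by rewrite count_mem_flatten_nseq ltn_ord (tnth_nth 0).
Qed.

Lemma sumn_kindex b n x : 0 < b -> sumn (kindex b n x) = n.
Proof.
move=> b0; rewrite -[RHS](size_digits b n x) sumnE big_tuple.
transitivity (\sum_(i < b) count_mem (i : nat) (digits b n x)).
  by apply: eq_bigr => i _; rewrite tnth_mktuple.
have : all (fun d => d < b) (digits b n x).
  by apply/allP => d /mapP[j _ ->]; rewrite ltn_mod.
elim: (digits b n x) => [|d s IH] /=; first by rewrite big1.
case/andP=> db sb; rewrite big_split /= IH // (bigD1 (Ordinal db)) //= eqxx.
rewrite big1 // => i ne; apply/eqP; rewrite eqb0 eq_sym; exact: ne.
Qed.

Lemma kaprekar_kindex b n x y : 0 < b ->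
  kindex b n x = kindex b n y -> kaprekar b n x = kaprekar b n y.
Proof.
move=> b0 E; rewrite /kaprekar.
suff -> : sort leq (digits b n x) = sort leq (digits b n y) by [].
apply/(perm_sortP leq_total leq_trans anti_leq).
have lt z d : d \in digits b n z -> d < b.
  by case/mapP=> j _ ->; rewrite ltn_mod.
apply/allP => d /=; rewrite mem_cat => dxy.
have db : d < b by case/orP: dxy; apply: lt.
move/(congr1 (fun t => tnth t (Ordinal db))): E.
by rewrite !tnth_mktuple /= => ->.
Qed.

Lemma ksuccE b n x : 0 < b ->
  ksucc (kindex b n x) = kindex b n (kaprekar b n x).
Proof.
move=> b0; rewrite /ksucc sumn_kindex //; congr kindex.
apply: kaprekar_kindex => //.
by rewrite -[RHS]kindex_krepr sumn_kindex.
Qed.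

Lemma kaprekar_subK b n x : 0 < b ->
  let a := sort leq (digits b n x) in
  kaprekar b n x + \sum_(j < n) nth 0 a j * b ^ (n - 1 - j)
    = \sum_(j < n) nth 0 a j * b ^ j.
Proof.
move=> b0 a; rewrite /kaprekar -/a subnK //.
have sa : size a = n by rewrite size_sort size_digits.
have mono i j : i <= j -> j < n -> nth 0 a i <= nth 0 a j.
  move=> ij jn; apply: (sorted_leq_nth leq_trans leqnn) => //.
  - exact: (sort_sorted leq_total).
  - by rewrite inE sa; apply: leq_ltn_trans jn.
  - by rewrite inE sa.
have revE (F : nat -> nat -> nat) :
    \sum_(j < n) F j (n - 1 - j) = \sum_(j < n) F (n - 1 - j) j.
  rewrite (reindex_inj rev_ord_inj) /=; apply: eq_bigr => j _.
  have -> : n - j.+1 = n - 1 - j by rewrite subnAC subn1 subnS.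
  congr F; rewrite subKn //.
  by rewrite subn1 -ltnS (ltn_predK (ltn_ord j)).
have H : \sum_(j < n) nth 0 a j * b ^ (n - 1 - j) +
           \sum_(j < n) nth 0 a (n - 1 - j) * b ^ j
      <= \sum_(j < n) nth 0 a j * b ^ j +
           \sum_(j < n) nth 0 a (n - 1 - j) * b ^ (n - 1 - j).
  rewrite -!big_split /=; apply: leq_sum => j _.
  have jn := ltn_ord j.
  have re (p q u v : nat) : p <= q -> u <= v -> p * v + q * u <= p * u + q * v.
    by move=> pq uv; nia.
  case: (leqP j (n - 1 - j)) => ij.
    by apply: re; [apply: mono => //; lia | rewrite leq_pexp2l].
  rewrite addnC [leqRHS]addnC.
  by apply: re; [apply: mono => //; lia | rewrite leq_pexp2l // ltnW].
rewrite -(revE (fun i j => nth 0 a i * b ^ j)) in H.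
rewrite -(revE (fun i j => nth 0 a i * b ^ i)) in H.
lia.
Qed.

(* Main.v *)
(* Put d = k_B - k_0, which is 0 in the symmetric case and smaller than every
   inner k_i in both cases. Writing the sorted digits above their reversal gives
   the pairs (0, B), k_0 times, and then for i = 1, ..., B the pairs
   (i, B + 1 - i), d times, and (i, B - i), k_i - d times. Subtracting columnwise,
   a pair (p, q) yields the digit B + p - q while a borrow is pending and p - q
   afterwards, up to a swap of one digit 0 with one digit 1 at the two ends of
   the borrow. Counting these digits shows that the successor of k moves the
   count of i to the digit 2 i mod B and fixes those of 0 and B. After sigma(B)
   steps i has moved to i or B - i, so the symmetry of k brings back k. *)
Require Import Defs.
From mathcomp Require Import all_boot all_order all_algebra.
From mathcomp Require Import zify.

Local Open Scope nat_scope.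

(** * Columnwise subtraction with borrows *)

Lemma of_digits_cons b d s : of_digits b (d :: s) = of_digits b s * b + d.
Proof.
rewrite /of_digits /= big_ord_recl /= muln1 addnC big_distrl /=.
by congr (_ + _); apply: eq_bigr => i _; rewrite /bump /= add1n expnSr mulnA.
Qed.

Lemma of_digits_cat b s t :
  of_digits b (s ++ t) = of_digits b s + b ^ size s * of_digits b t.
Proof.
elim: s => [|d s IH] /=; first by rewrite {2}/of_digits big_ord0 mul1n.
by rewrite !of_digits_cons IH expnS; lia.
Qed.

Lemma of_digits_rev b s :
  of_digits b (rev s) = \sum_(j < size s) nth 0 s j * b ^ (size s - 1 - j).
Proof.
rewrite /of_digits size_rev (reindex_inj rev_ord_inj) /=.
apply: eq_bigr => j _; have js := ltn_ord j.
rewrite nth_rev; last by lia.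
by congr (nth 0 s _ * b ^ _); lia.
Qed.

(* For [z.1 = z.2] the borrow is still pending, hence the non-strict comparison. *)
Definition pair_digit (B : nat) (z : nat * nat) : nat :=
  if z.1 <= z.2 then B + z.1 - z.2 else z.1 - z.2.

(** The summand 1 is the borrow entering the lowest column and the power is the borrow leaving the
    top one: [u.1 <= u.2] makes every column pass it on. *)
Lemma of_digits_borrow B z : all (fun u => u.1 <= u.2 <= B) z ->
  of_digits B.+1 [seq pair_digit B u | u <- z] + of_digits B.+1 (unzip2 z) + 1
    = of_digits B.+1 (unzip1 z) + B.+1 ^ size z.
Proof.
elim: z => [|[p q] z IH] /=; first by rewrite /of_digits !big_ord0.
case/andP=> /andP[pq qB] /IH /(congr1 (muln^~ B.+1)).
by rewrite !of_digits_cons /pair_digit /= pq expnS !mulnDl; lia.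
Qed.

Lemma of_digits_no_borrow B z : all (fun u => u.2 < u.1) z ->
  of_digits B.+1 [seq pair_digit B u | u <- z] + of_digits B.+1 (unzip2 z)
    = of_digits B.+1 (unzip1 z).
Proof.
elim: z => [|[p q] z IH] /=; first by rewrite /of_digits !big_ord0.
case/andP=> pq /IH /(congr1 (muln^~ B.+1)).
by rewrite !of_digits_cons /pair_digit /= leqNgt pq /= !mulnDl; lia.
Qed.

(* The borrow turns the 0 in position 0 into a 1 and the 1 in the position
   of [(p.+1, p)] into a 0, which leaves the multiset of digits unchanged. *)
Lemma kaprekar_digit_pairs B p L R :
  let z := (0, B) :: L ++ (p.+1, p) :: R in
  all (fun u => u.1 <= u.2 <= B) L -> all (fun u => u.2 < u.1 <= B) R ->
  p < B -> unzip2 z = rev (unzip1 z) ->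
  exists t, [/\ size t = size z,
    of_digits B.+1 t + of_digits B.+1 (rev (unzip1 z))
      = of_digits B.+1 (unzip1 z),
    all (fun d => d < B.+1) t &
    perm_eq t [seq pair_digit B u | u <- z]].
Proof.
move=> z hL hR pB zE.
pose f := pair_digit B.
have hR' : all (fun u => u.2 < u.1) ((p.+1, p) :: R).
  by rewrite /= ltnSn /=; apply: sub_all hR => u /andP[].
have hL' : all (fun u => u.1 <= u.2 <= B) ((0, B) :: L) by rewrite /= leqnn.
have f0 : f (0, B) = 0 by rewrite /f /pair_digit /= addn0 subnn.
have f1 : f (p.+1, p) = 1 by rewrite /f /pair_digit /= ltnn subSnn.
exists (1 :: map f L ++ 0 :: map f R).
have pE : perm_eq (1 :: map f L ++ 0 :: map f R) (map f z).
  rewrite /z /= map_cat /= f0 f1; apply/permP => P.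
  by rewrite /= !count_cat /=; lia.
split=> //; first by rewrite (perm_size pE) size_map.
- rewrite -zE /unzip1 /unzip2.
  have -> : z = ((0, B) :: L) ++ ((p.+1, p) :: R) by [].
  move: (of_digits_borrow _ _ hL') (of_digits_no_borrow B _ hR').
  rewrite -/f !map_cat /= f0 f1 -!cat_cons !of_digits_cat /= !size_map.
  rewrite /unzip1 /unzip2 !of_digits_cons /=.
  set X := of_digits _ (map f L); set Y := of_digits _ (map f R).
  set X1 := of_digits _ [seq i.1 | i <- L].
  set X2 := of_digits _ [seq i.2 | i <- L].
  set Y1 := of_digits _ [seq i.1 | i <- R].
  set Y2 := of_digits _ [seq i.2 | i <- R].
  (* [E] is the weight of the column [(p.+1, p)], which repays the borrow: the first identity plus
     [E] times the second. *)
  by move: (_ ^ _) => E; nia.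
- rewrite (perm_all _ pE) all_map; apply/allP => -[i j] uz /=.
  have : (i <= j <= B) || (j < i <= B).
    move: uz; rewrite /z inE mem_cat inE => /or4P[/eqP[-> ->]|u|/eqP[-> ->]|u].
    + by rewrite leqnn.
    + by move: (allP hL _ u) => /= ->.
    + by rewrite ltnSn pB orbT.
    + by move: (allP hR _ u) => /= ->; rewrite orbT.
  by rewrite /f /pair_digit /=; case: ifP; lia.
Qed.

(* [k i] counts the digit [i]; [d = 0] is the symmetric case. *)
Definition near_symmetric (B d : nat) (k : nat -> nat) : Prop :=
  [/\ 0 < k 0, k B = k 0 + d &
      forall i, 0 < i < B -> d < k i /\ k (B - i) = k i].

(** * The columns formed by the sorted digits and their reversal *)

Definition sorted_digits (k : nat -> nat) (m : nat) : seq nat :=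
  flatten (mkseq (fun i => nseq (k i) i) m).

Lemma sorted_digitsS k m :
  sorted_digits k m.+1 = sorted_digits k m ++ nseq (k m) m.
Proof. by rewrite /sorted_digits mkseqS flatten_rcons. Qed.

(** The reversal starts with [d] more copies of [B] than there are zeros, so it lags: the first [d]
    copies of [i] still meet [B.+1 - i]. *)
Definition digit_block (B d : nat) (k : nat -> nat) (i : nat) :
    seq (nat * nat) :=
  nseq d (i, B.+1 - i) ++ nseq (k i - d) (i, B - i).

Definition digit_pairs (B d : nat) (k : nat -> nat) : seq (nat * nat) :=
  nseq (k 0) (0, B) ++ flatten [seq digit_block B d k i | i <- iota 1 B].

Lemma unzip1_digit_pairs B d k : near_symmetric B d k ->
  unzip1 (digit_pairs B d k) = sorted_digits k B.+1.
Proof.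
case=> k0 kB kS.
rewrite /digit_pairs /unzip1 map_cat map_nseq /sorted_digits /mkseq /=.
congr (_ ++ _); rewrite map_flatten -map_comp; congr flatten.
apply/eq_in_map => i; rewrite mem_iota => iB /=.
rewrite /digit_block map_cat !map_nseq -nseqD subnKC //.
case: (ltnP i B) => [lt|ge]; first by case: (kS i _) => [|/ltnW //]; lia.
have -> : i = B by lia.
by rewrite kB leq_addl.
Qed.

Lemma iota1_rcons m : iota 1 m.+1 = rcons (iota 1 m) m.+1.
Proof. by rewrite -(addn1 m) iotaD /= add1n addn1 cats1. Qed.

Lemma unzip2_digit_pairs B d k : 0 < B -> near_symmetric B d k ->
  unzip2 (digit_pairs B d k) = rev (sorted_digits k B.+1).
Proof.
move=> B0 [k0 kB kS].
(* Invariant after [m] blocks: [d] copies of [B - m] and all smaller digits are still unread. Block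
   [B] is treated apart, because its count mirrors [k 0] only up to [d]. *)
have H m : m < B ->
    nseq (k 0) B ++ unzip2 (flatten [seq digit_block B d k i | i <- iota 1 m])
      ++ nseq d (B - m) ++ rev (sorted_digits k (B - m))
    = rev (sorted_digits k B.+1).
  elim: m => [_|m IH mB].
    rewrite /= subn0 sorted_digitsS rev_cat rev_nseq kB nseqD -catA //.
  rewrite iota1_rcons -(IH (ltnW mB)) map_rcons flatten_rcons.
  rewrite /unzip2 map_cat -!catA; congr (_ ++ (_ ++ _)).
  rewrite /digit_block map_cat !map_nseq subSS -!catA; congr (_ ++ _).
  have -> : B - m = (B - m.+1).+1 by lia.
  rewrite sorted_digitsS rev_cat rev_nseq.
  have [dk ->] : d < k m.+1 /\ k (B - m.+1) = k m.+1 by apply: kS; lia.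
  by rewrite catA /= -nseqD subnK // ltnW.
rewrite -(H B.-1) ?prednK // /digit_pairs /unzip2 !map_cat map_nseq /=.
have -> : iota 1 B = rcons (iota 1 B.-1) B.
  by rewrite -[in LHS](prednK B0) iota1_rcons prednK.
congr (_ ++ _); rewrite map_rcons flatten_rcons map_cat; congr (_ ++ _).
rewrite /digit_block map_cat !map_nseq subnn subSnn kB addnK.
have -> : B - B.-1 = 1 by lia.
by rewrite /sorted_digits /= cats0 rev_nseq.
Qed.

(* The inverse of doubling modulo [B], for odd [B], with [B] sent to [B]. *)
Definition halve (B e : nat) : nat := if odd e then (e + B)./2 else e./2.

(** * Digit counts of the successor *)

Lemma sum_pick (m n j : nat) (c : nat -> nat) (P : nat -> bool) : m <= j < n ->
  (forall i, m <= i < n -> P i = (i == j)) ->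
  \sum_(i <- index_iota m n) P i * c i = c j.
Proof.
move=> mjn hP; rewrite (bigD1_seq j) ?iota_uniq ?mem_index_iota //=.
rewrite hP // eqxx mul1n big1_seq ?addn0 // => i /andP[ij].
by rewrite mem_index_iota => /hP ->; rewrite (negbTE ij).
Qed.

(** The first [d] columns of block [i] give [2 i - 1] or [2 i - B - 1], the others [2 i] or
    [2 i - B]. So [e > 0] gets [d] from a single block of the first kind and [k i - d] from the
    block [i = halve B e]. Digit 0 comes from [(0, B)] alone. *)
Lemma count_digit_pairs B d k e : odd B -> near_symmetric B d k -> e <= B ->
  count_mem e [seq pair_digit B u | u <- digit_pairs B d k] = k (halve B e).
Proof.
move=> oB [k0 kB kS] eB.
rewrite /digit_pairs map_cat count_cat map_nseq count_nseq map_flatten.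
rewrite count_flatten -!map_comp sumnE big_map.
rewrite (_ : iota 1 B = index_iota 1 B.+1); last by rewrite /index_iota subn1.
under eq_bigr => i _ do
  rewrite /= /digit_block map_cat count_cat !map_nseq !count_nseq.
rewrite big_split /= /pair_digit /= addn0 subnn.
have [->|e0] := eqVneq e 0.
  rewrite mul1n !big1_seq ?addn0 // => i /andP[_]; rewrite mem_index_iota => iB.
    by rewrite [_ == 0](_ : _ = false) //; case: ifP; lia.
  by rewrite [_ == 0](_ : _ = false) //; case: ifP; lia.
rewrite mul0n add0n.
rewrite (sum_pick _ _ (if odd e then (e.+1)./2 else (e + B.+1)./2) (fun=> d));
  last first.
- by move=> i iB; case: ifP; case: ifP; lia.
- by case: ifP; lia.
rewrite (sum_pick _ _ (halve B e) (fun i => k i - d)) /halve; last first.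
- by move=> i iB; case: ifP; case: ifP; lia.
- by case: ifP; lia.
set j := if odd e then _ else _.
rewrite subnKC //.
case: (ltnP j B) => [lt|ge].
  by case: (kS j _) => [|/ltnW //]; rewrite /j; case: ifP lt => *; lia.
have -> : j = B by move: ge; rewrite /j; case: ifP => *; lia.
by rewrite kB leq_addl.
Qed.

Lemma sorted_digits_lt k m : all (fun d => d < m) (sorted_digits k m).
Proof.
apply/allP => d /flatten_mapP[i]; rewrite mem_iota mem_nseq => im /andP[_ /eqP->].
by case/andP: im.
Qed.

Lemma sorted_sorted_digits k m : sorted leq (sorted_digits k m).
Proof.
rewrite (sorted_pairwise leq_trans).
elim: m => [//|m IH]; rewrite sorted_digitsS pairwise_cat IH /=; apply/andP; split.
  apply/allrelP => i j /(allP (sorted_digits_lt k m)) im.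
  by rewrite mem_nseq => /andP[_ /eqP->]; apply: ltnW.
elim: (k m) => //= c IHc; rewrite {}IHc andbT.
by apply/allP => j; rewrite mem_nseq => /andP[_ /eqP->].
Qed.

Lemma size_sorted_digits (b : nat) (k : b.-tuple nat) :
  size (sorted_digits (nth 0 k) b) = sumn k.
Proof.
rewrite size_flatten /shape -map_comp; congr sumn.
rewrite -[RHS](mkseq_nth 0) size_tuple; apply: eq_map => j /=.
by rewrite size_nseq.
Qed.

Lemma kaprekar_krepr (b : nat) (k : b.-tuple nat) :
  let s := sorted_digits (nth 0 k) b in
  kaprekar b (sumn k) (krepr k) = of_digits b s - of_digits b (rev s).
Proof.
rewrite /= /kaprekar -size_sorted_digits /krepr -/(sorted_digits (nth 0 k) b).
set s := sorted_digits _ _.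
rewrite digitsK ?sorted_digits_lt // sorted_sort ?sorted_sorted_digits //.
  by rewrite of_digits_rev.
exact: leq_trans.
Qed.

(** For [B = 2 p + 1] the borrow ends inside block [p.+1], after its [d] columns with equal entries;
    [d < k p.+1] ensures that a column [(p.+1, p)] follows. *)
Lemma digit_pairs_split B d k : odd B -> 1 < B -> near_symmetric B d k ->
  exists p L R, [/\ digit_pairs B d k = (0, B) :: L ++ (p.+1, p) :: R, p < B,
    all (fun u => u.1 <= u.2 <= B) L & all (fun u => u.2 < u.1 <= B) R].
Proof.
move=> oB B1 [k0 kB kS]; set p := B./2.
have Bp : B = p + p.+1 by rewrite /p; lia.
have [dk _] : d < k p.+1 /\ k (B - p.+1) = k p.+1 by apply: kS; lia.
exists p, (nseq (k 0).-1 (0, B)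
    ++ flatten [seq digit_block B d k i | i <- iota 1 p]
    ++ nseq d (p.+1, B.+1 - p.+1)),
  (nseq (k p.+1 - d).-1 (p.+1, p)
    ++ flatten [seq digit_block B d k i | i <- iota p.+2 p]).
split; last first.
- rewrite all_cat; apply/andP; split.
    by apply/allP => u; rewrite mem_nseq => /andP[_ /eqP->] /=; lia.
  apply/allP => u /flatten_mapP[i]; rewrite mem_iota /digit_block => hi.
  by rewrite mem_cat !mem_nseq => /orP[] /andP[_ /eqP->] /=; lia.
- rewrite !all_cat; apply/and3P; split.
  + by apply/allP => u; rewrite mem_nseq => /andP[_ /eqP->] /=; lia.
  + apply/allP => u /flatten_mapP[i]; rewrite mem_iota /digit_block => hi.
    by rewrite mem_cat !mem_nseq => /orP[] /andP[_ /eqP->] /=; lia.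
  + by apply/allP => u; rewrite mem_nseq => /andP[_ /eqP->] /=; lia.
- by lia.
- have iE : iota 1 B = iota 1 p ++ p.+1 :: iota p.+2 p.
    by rewrite [in LHS]Bp iotaD /= add1n.
  rewrite /digit_pairs iE map_cat flatten_cat /=.
  rewrite {2}/digit_block -[in nseq (k 0)](prednK k0) /=.
  have -> : B - p.+1 = p by lia.
  rewrite -[k p.+1 - d]prednK ?subn_gt0 //=.
  by rewrite -!catA.
Qed.

Lemma nth_ksucc B d (k : B.+1.-tuple nat) : odd B -> 1 < B ->
  near_symmetric B d (nth 0 k) ->
  forall e, e <= B -> nth 0 (ksucc k) e = nth 0 k (halve B e).
Proof.
move=> oB B1 kN e eB; have B0 : 0 < B by apply: ltnW.
have [p [L [R [zE pB hL hR]]]] := digit_pairs_split _ _ _ oB B1 kN.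
have u1 := unzip1_digit_pairs _ _ _ kN.
have u2 := unzip2_digit_pairs _ _ _ B0 kN.
have := kaprekar_digit_pairs _ _ _ _ hL hR pB; lazy zeta; rewrite -zE u1.
case=> [//|t [szt tE tB tP]].
have st : size t = sumn k.
  by rewrite szt -size_sorted_digits -u1 size_map.
(* Having [sumn k] entries below the base, [t] is the digit string of the difference, leading zeros
   included. *)
rewrite /ksucc kaprekar_krepr -tE addnK -st.
rewrite (nth_map ord0) ?size_enum_ord // digitsK // nth_enum_ord //.
by rewrite (permP tP) (count_digit_pairs _ d).
Qed.

(** * Iterated halving modulo [B] *)

Lemma halve_bound B e : odd B -> 0 < e < B -> 0 < halve B e < B.
Proof. by rewrite /halve; case: ifP; lia. Qed.

Lemma double_halve_mod B e : odd B -> 2 * halve B e = e %[mod B].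
Proof.
rewrite /halve => oB; case: ifP => oe.
  by rewrite (_ : 2 * _ = e + B) ?modnDr //; lia.
by congr (_ %% _); lia.
Qed.

(** [halve B] fixes 0 and [B] and commutes with [i -> B - i] on inner digits, so the same [d] serves
    along the whole orbit. *)
Lemma near_symmetric_ksucc B d (k : B.+1.-tuple nat) : odd B -> 1 < B ->
  near_symmetric B d (nth 0 k) -> near_symmetric B d (nth 0 (ksucc k)).
Proof.
move=> oB B1 kN; have kE := nth_ksucc _ _ _ oB B1 kN.
case: kN => k0 kB kS; split.
- by rewrite kE.
- rewrite !kE // (_ : halve B B = B) //; by rewrite /halve oB; lia.
- move=> i iB; have hi := halve_bound _ _ oB iB.
  rewrite !kE; try lia.
  rewrite (_ : halve B (B - i) = B - halve B i); first exact: kS.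
  by move: hi; rewrite /halve; case: ifP; case: ifP; lia.
Qed.

Lemma nth_iter_ksucc B d m (k : B.+1.-tuple nat) : odd B -> 1 < B ->
  near_symmetric B d (nth 0 k) ->
  forall e, e <= B ->
    nth 0 (iter m (@ksucc B.+1) k) e = nth 0 k (iter m (halve B) e).
Proof.
move=> oB B1; elim: m k => [//|m IH] k kN e eB.
have hB i : i <= B -> halve B i <= B by rewrite /halve; case: ifP; lia.
rewrite iterSr IH //; last exact: near_symmetric_ksucc.
by apply: (nth_ksucc _ d) => //; elim: m {IH} => //= m IHm; apply: hB.
Qed.

Lemma iter_halve_bound B m e : odd B -> 0 < e < B ->
  0 < iter m (halve B) e < B.
Proof. by move=> oB eB; elim: m => //= m; apply: halve_bound. Qed.

Lemma iter_halve_mod B m e : odd B -> 2 ^ m * iter m (halve B) e = e %[mod B].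
Proof.
move=> oB; elim: m => [|m IH] /=; first by rewrite mul1n.
by rewrite expnSr -mulnA -modnMmr double_halve_mod // modnMmr.
Qed.

Lemma pow2_pm1P r s : pow2_pm1 r s -> 2 ^ s = 1 %[mod r] \/ r %| 2 ^ s + 1.
Proof.
case/orP.
  by rewrite (modz_nat 1) modz_nat => /eqP[]; left.
by rewrite eqz_mod_dvd GRing.opprK -PoszD; right.
Qed.

(** Since [2 ^ sigma B] is 1 or -1 modulo [B], [i] is congruent to [e] or [- e]; both lie strictly
    between 0 and [B]. *)
Lemma iter_halve_sigma B e : odd B -> 0 < e < B ->
  let i := iter (sigma B) (halve B) e in i = e \/ i = B - e.
Proof.
move=> oB eB i; have /= iB : 0 < i < B := iter_halve_bound _ _ _ oB eB.
have iE : 2 ^ sigma B * i = e %[mod B] := iter_halve_mod _ _ _ oB.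
have [_ /pow2_pm1P[E|E] _] := sigmaP oB.
  left; rewrite -modnMml E modnMml mul1n in iE.
  by rewrite !modn_small // in iE; lia.
right; have : B %| e + i.
  rewrite /dvdn -modnDml -iE modnDml -{2}(mul1n i) -mulnDl.
  by rewrite -/(dvdn _ _) dvdn_mulr.
by case/dvdnP => -[|[|q]]; rewrite ?mulSn; lia.
Qed.

(** * Cycle lengths and the two kinds of index *)

Lemma min_period_dvdn (T : Type) (f : T -> T) (x : T) l s :
  0 < l -> iter l f x = x ->
  (forall m, 0 < m -> iter m f x = x -> l <= m) ->
  iter s f x = x -> l %| s.
Proof.
move=> l0 lx lmin sx; rewrite /dvdn -leqn0 leqNgt; apply/negP => r0.
(* The remainder is itself a period, so a nonzero one would contradict minimality. *)
have : l <= s %% l.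
  apply: lmin => //; move: sx; rewrite {1}(divn_eq s l) addnC iterD.
  by rewrite iterM (iter_fix (s %/ l) lx).
by rewrite leqNgt ltn_mod l0.
Qed.

Lemma in_cycle_dvdn b (k : b.-tuple nat) s :
  0 < s -> iter s (@ksucc b) k = k ->
  exists l, in_cycle_of_length k l /\ l %| s.
Proof.
move=> s0 sk.
have : exists l, (0 < l) && (iter l (@ksucc b) k == k).
  by exists s; rewrite s0 sk eqxx.
move=> ex; case: (ex_minnP ex) => l /andP[l0 /eqP lk] lmin.
have lmin' m : 0 < m -> iter m (@ksucc b) k = k -> l <= m.
  by move=> m0 mk; apply: lmin; rewrite m0 mk eqxx.
by exists l; split; [split | apply: (min_period_dvdn _ _ _ _ _ l0 lk)].
Qed.

Lemma big_minn_le (x0 j : nat) (r : seq nat) (F : nat -> nat) : j \in r ->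
  \big[minn/x0]_(i <- r) F i <= F j.
Proof.
elim: r => // i r IH; rewrite inE big_cons geq_min => /orP[/eqP-> | /IH ->].
  by rewrite leqnn.
by rewrite orbT.
Qed.

(** For [d = 0] the bound [d < k i] is fullness; for [d = k B - k 0] it is the upper bound through
    the minimum. *)
Lemma near_symmetric_index B (k : B.+1.-tuple nat) :
  1 < B -> symmetric_index k \/ almost_symmetric_index k ->
  exists d, near_symmetric B d (nth 0 k).
Proof.
move=> B1 [[kF kS]|[kF kS /andP[lt0 ltm]]].
  exists 0; split; first exact: kF.
    by rewrite addn0 -[in RHS](kS 0) // subn0.
  by move=> i iB; split; [apply: kF | apply: kS]; lia.
exists (nth 0 k B - nth 0 k 0); split; first exact: kF.
  by rewrite subnKC // ltnW.
move=> i iB; split; last exact: kS.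
rewrite ltn_subLR ?(ltnW lt0) //; apply: leq_trans ltm _.
by rewrite leq_add2l (big_minn_le _ i) // mem_index_iota.
Qed.

Theorem theorem9 (b : nat) (hb4 : 4 <= b) (hbeven : ~~ odd b)
    (k : b.-tuple nat)
    (hk : symmetric_index k \/ almost_symmetric_index k)
    (hne : ~ (forall i j, 1 <= i < b.-1 -> 1 <= j < b.-1 ->
                nth 0 k i = nth 0 k j)) :
  exists l, in_cycle_of_length k l /\ l %| sigma b.-1.
Proof.
case: b hb4 hbeven k hk {hne} => // B hB /negPn oB k hk.
rewrite -/(odd B) in oB.
have B1 : 1 < B by apply: ltnW.
have [d kN] := near_symmetric_index _ _ B1 hk.
apply: in_cycle_dvdn; first by case: (sigmaP oB).
apply: val_inj; apply: (@eq_from_nth _ 0) => [|e]; rewrite !size_tuple // ltnS => eB.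
(* The end digits are fixed by [halve B]; an inner [e] goes to [e] or [B - e], where the counts
   agree. *)
rewrite (nth_iter_ksucc _ d) //; case: (posnP e) => [->|e0].
  by rewrite iter_fix.
case: (ltnP e B) => [lt|ge].
  have eB' : 0 < e < B by rewrite e0.
  case: kN => _ _ kS; case: (iter_halve_sigma _ _ oB eB') => -> //.
  by case: (kS e eB').
by rewrite (_ : e = B) ?iter_fix //; last lia; rewrite /halve oB; lia.
Qed.
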